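(* For the diamond network with orthogonal broadcast links, bit-pipe capacities $C_1,C_2$, and discrete memoryless MAC $p(y|x_1,x_2)$, the capacity satisfies $$C^\diamond\le \max_{p(x_1,x_2)}\ \min_{p(u|y)}\ \min\left\{\begin{array}{l} C_1+C_2,\\ C_1+I(X_2;Y|X_1),\\ C_2+I(X_1;Y|X_2),\\ I(X_1X_2;Y),\\ \tfrac12\big(C_1+C_2+I(X_1X_2;Y|U)+I(X_1;U|X_2)+I(X_2;U|X_1)\big)\end{array}\right\},$$ where the minimum is over auxiliary channels $p(u|y)$ (with $U$ in an arbitrary finite alphabet) and all quantities are evaluated for the joint pmf $p(x_1,x_2)p(y|x_1,x_2)p(u|y)$.
   Context: Diamond network with orthogonal broadcast component: a message $W$ uniformly distributed on $\{1,\dots,2^{nR}\}$ is encoded into $(V_1^n,V_2^n)$ with $H(V_1^n)\le nC_1$, $H(V_2^n)\le nC_2$; $V_i^n$ is delivered without error to relay $i$, which maps it to $X_i^n\in\mathcal X_i^n$. $(X_1^n,X_2^n)$ is sent over $n$ uses of a memoryless MAC $p(y|x_1,x_2)$ with finite alphabets, giving $Y^n$, from which a decoder forms $\hat W$. $R$ is achievable if $\Pr(\hat W\ne W)$ can be made arbitrarily small for some $n$; $C^\diamond$ is the supremum of achievable rates. Logarithms base 2. *)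

(* Defs.v *)
From HB Require Import structures.
From mathcomp Require Import all_boot.
From Stdlib Require Import Reals.
Set Implicit Arguments. Unset Strict Implicit. Unset Printing Implicit Defensive.
Open Scope R_scope.

Definition sumR (T : finType) (f : T -> R) : R := \big[Rplus/0]_(x : T) f x.
Definition prodR (n : nat) (f : 'I_n -> R) : R := \big[Rmult/1]_(t < n) f t.

Definition log2 (x : R) : R := ln x / ln 2.
Definition xlog2x (x : R) : R := if Rle_dec x 0 then 0 else x * log2 x.

Definition is_pmf (T : finType) (p : T -> R) : Prop :=
  (forall x, 0 <= p x) /\ sumR p = 1.

Definition marg (T S : finType) (P : T -> R) (f : T -> S) (s : S) : R :=
  sumR (fun t => if f t == s then P t else 0).

Definition entropy (T S : finType) (P : T -> R) (f : T -> S) : R :=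
  - sumR (fun s : S => xlog2x (marg P f s)).

Definition pairRV (T A B : Type) (f : T -> A) (g : T -> B) : T -> A * B :=
  fun t => (f t, g t).

Definition mi (T A B : finType) (P : T -> R) (a : T -> A) (b : T -> B) : R :=
  entropy P a + entropy P b - entropy P (pairRV a b).

Definition cmi (T A B C : finType) (P : T -> R)
    (a : T -> A) (b : T -> B) (c : T -> C) : R :=
  entropy P (pairRV a c) + entropy P (pairRV b c)
  - entropy P (pairRV (pairRV a b) c) - entropy P c.

Definition uniform (M : nat) : 'I_M -> R := fun _ => / INR M.
Arguments uniform M : clear implicits.

(* Average error probability of a deterministic diamond-network code of
   block length n with M messages: encoder (f1,f2) : W |-> (V1^n, V2^n),
   relays g1, g2 : V_i^n |-> X_i^n, decoder dec : Y^n -> message. *)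
Definition err_prob (X1 X2 Y V1 V2 : finType) (W : X1 -> X2 -> Y -> R)
    (n M : nat) (f1 : 'I_M -> V1) (f2 : 'I_M -> V2)
    (g1 : V1 -> {ffun 'I_n -> X1}) (g2 : V2 -> {ffun 'I_n -> X2})
    (dec : {ffun 'I_n -> Y} -> 'I_M) : R :=
  / INR M * sumR (fun w : 'I_M =>
    sumR (fun y : {ffun 'I_n -> Y} =>
      if dec y == w then 0
      else prodR (fun t => W (g1 (f1 w) t) (g2 (f2 w) t) (y t)))).

Definition achievable (X1 X2 Y : finType) (W : X1 -> X2 -> Y -> R)
    (C1 C2 : R) (Rt : R) : Prop :=
  forall eps, 0 < eps ->
  exists (n M : nat) (V1 V2 : finType)
         (f1 : 'I_M -> V1) (f2 : 'I_M -> V2)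
         (g1 : V1 -> {ffun 'I_n -> X1}) (g2 : V2 -> {ffun 'I_n -> X2})
         (dec : {ffun 'I_n -> Y} -> 'I_M),
    leq 1 n /\
    Rpower 2 (INR n * Rt) <= INR M /\
    entropy (uniform M) f1 <= INR n * C1 /\
    entropy (uniform M) f2 <= INR n * C2 /\
    err_prob W f1 f2 g1 g2 dec <= eps.

Definition diamond_bound (X1 X2 Y U : finType) (C1 C2 : R)
    (W : X1 -> X2 -> Y -> R) (px : X1 * X2 -> R) (q : Y -> U -> R) : R :=
  let P := fun t : X1 * X2 * Y * U =>
             px (t.1.1.1, t.1.1.2) * W t.1.1.1 t.1.1.2 t.1.2 * q t.1.2 t.2 in
  let x1 := fun t : X1 * X2 * Y * U => t.1.1.1 in
  let x2 := fun t : X1 * X2 * Y * U => t.1.1.2 in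
  let y  := fun t : X1 * X2 * Y * U => t.1.2 in
  let u  := fun t : X1 * X2 * Y * U => t.2 in
  Rmin (C1 + C2)
  (Rmin (C1 + cmi P x2 y x1)
  (Rmin (C2 + cmi P x1 y x2)
  (Rmin (mi P (pairRV x1 x2) y)
        (/ 2 * (C1 + C2 + cmi P (pairRV x1 x2) y u
                + cmi P x1 u x2 + cmi P x2 u x1))))).

(* Main.v *)
(** Replacing the link messages by the channel inputs X1^n, X2^n only lowers their
    entropies, so only the joint law of (X1^n, X2^n) matters.  With
    J = I(X1^n X2^n; Y^n), Fano's inequality gives nR <= J + o(1), and for U^n
    obtained from Y^n letter by letter through p(u|y),

      J <= H(X1^n X2^n) <= H(X1^n) + H(X2^n) - I(X1^n; X2^n),
      I(X1^n; X2^n) >= I(X1^n X2^n; U^n) - I(X2^n; U^n|X1^n) - I(X1^n; U^n|X2^n),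

    the second line being I(X1^n; X2^n|U^n) >= 0.  Adding J to the first line gives the
    last term of the minimum.  What remains are conditional entropies
    H(F^n|G^n): Gibbs' inequality bounds each by n times its single-letter value at the
    input law averaged over time, with equality for H(Y^n|X1^n X2^n), H(U^n|X1^n X2^n)
    and H(U^n|Y^n), the ones with a negative sign.  This input law depends neither on U
    nor on p(u|y).  Finally, as the error tends to 0, these
    input laws accumulate at a law where, by continuity, the bound holds. *)

Require Import Defs.
From HB Require Import structures.
From mathcomp Require Import all_boot.
From Stdlib Require Import Reals Lra FunctionalExtensionality ClassicalEpsilon.
Set Implicit Arguments. Unset Strict Implicit. Unset Printing Implicit Defensive.
Open Scope R_scope.

(** * Finite sums and products *)

Fact Rplus_assoc_law : associative Rplus. Proof. by move=> x y z; lra. Qed.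
Fact Rmult_assoc_law : associative Rmult. Proof. by move=> x y z; lra. Qed.
HB.instance Definition _ :=
  Monoid.isComLaw.Build R 0 Rplus Rplus_assoc_law Rplus_comm Rplus_0_l.
HB.instance Definition _ :=
  Monoid.isComLaw.Build R 1 Rmult Rmult_assoc_law Rmult_comm Rmult_1_l.
HB.instance Definition _ := Monoid.isMulLaw.Build R 0 Rmult Rmult_0_l Rmult_0_r.
HB.instance Definition _ :=
  Monoid.isAddLaw.Build R Rmult Rplus Rmult_plus_distr_r Rmult_plus_distr_l.

Section Sums.
Variables (T S : finType).
Implicit Types (f g : T -> R).

Lemma eq_sumR f g : f =1 g -> sumR f = sumR g.
Proof. by move=> fg; apply: eq_bigr => x _; apply: fg. Qed.

Lemma sumR_add f g : sumR (fun x => f x + g x) = sumR f + sumR g.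
Proof. exact: big_split. Qed.

Lemma sumR_mull c f : sumR (fun x => c * f x) = c * sumR f.
Proof. by rewrite /sumR big_distrr. Qed.

Lemma sumR_mulr c f : sumR (fun x => f x * c) = sumR f * c.
Proof. by rewrite /sumR big_distrl. Qed.

Lemma sumR_opp f : sumR (fun x => - f x) = - sumR f.
Proof.
rewrite (eq_sumR (g := fun x => -1 * f x)); last by move=> x; lra.
by rewrite sumR_mull; lra.
Qed.

Lemma sumR_exch (F : T -> S -> R) :
  sumR (fun x => sumR (F x)) = sumR (fun y => sumR (fun x => F x y)).
Proof. exact: exchange_big. Qed.

Lemma sumR_pair (F : T * S -> R) :
  sumR F = sumR (fun x => sumR (fun y => F (x, y))).
Proof.
by rewrite /sumR pair_bigA; apply: eq_bigr => -[].
Qed.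

Lemma sumR_le f g : (forall x, f x <= g x) -> sumR f <= sumR g.
Proof. by move=> fg; apply: (big_ind2 Rle) => // *; lra. Qed.

Lemma sumR_ge0 f : (forall x, 0 <= f x) -> 0 <= sumR f.
Proof. by move=> f0; apply: big_ind => // *; lra. Qed.

Lemma sumR_D1 f a : sumR f = f a + \big[Rplus/0]_(x | x != a) f x.
Proof. exact: bigD1. Qed.

Lemma sumR_ge_term f a : (forall x, 0 <= f x) -> f a <= sumR f.
Proof.
move=> f0; rewrite (sumR_D1 _ a).
have : 0 <= \big[Rplus/0]_(x | x != a) f x by apply: big_ind => // *; lra.
by lra.
Qed.

Lemma sumR_delta f a : sumR (fun x => if x == a then f x else 0) = f a.
Proof. by rewrite /sumR -big_mkcond big_pred1_eq. Qed.

Lemma sumR_delta_sym f a : sumR (fun x => if a == x then f x else 0) = f a.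
Proof. by rewrite -[RHS]sumR_delta; apply: eq_sumR => x; rewrite eq_sym. Qed.

End Sums.

Lemma sumR_const m (c : R) : sumR (fun _ : 'I_m => c) = INR m * c.
Proof.
rewrite /sumR big_const_ord; elim: m => [|m IH]; first by rewrite /=; lra.
by rewrite iterS IH S_INR; lra.
Qed.

(** * Base-2 logarithms and products over a block *)

Lemma ln2_gt0 : 0 < ln 2.
Proof. by rewrite -ln_1; apply: ln_increasing; lra. Qed.

Lemma log2_1 : log2 1 = 0.
Proof. by rewrite /log2 ln_1 /Rdiv Rmult_0_l. Qed.

Lemma log2_le x y : 0 < x -> x <= y -> log2 x <= log2 y.
Proof.
move=> x0 [xy|->]; last exact: Rle_refl.
apply: Rmult_le_compat_r; last by apply/Rlt_le/ln_increasing.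
by apply/Rlt_le/Rinv_0_lt_compat/ln2_gt0.
Qed.

Lemma log2M x y : 0 < x -> 0 < y -> log2 (x * y) = log2 x + log2 y.
Proof. by move=> x0 y0; rewrite /log2 ln_mult // /Rdiv; lra. Qed.

Lemma log2V x : 0 < x -> log2 (/ x) = - log2 x.
Proof. by move=> x0; rewrite /log2 ln_Rinv // /Rdiv; lra. Qed.

Lemma log2_leB1 x : 0 < x -> log2 x <= (x - 1) / ln 2.
Proof.
move=> x0; apply: Rmult_le_compat_r.
  by apply/Rlt_le/Rinv_0_lt_compat/ln2_gt0.
by have := exp_ineq1_le (ln x); rewrite exp_ln //; lra.
Qed.

Lemma log2_Rpower x : log2 (Rpower 2 x) = x.
Proof. by rewrite /log2 /Rpower ln_exp; field; have := ln2_gt0; lra. Qed.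

Lemma prodR_gt0 n (k : 'I_n -> R) : (forall i, 0 < k i) -> 0 < prodR k.
Proof. by move=> k0; apply: big_ind => // *; [lra|apply: Rmult_lt_0_compat]. Qed.

Lemma prodR_ge0 n (k : 'I_n -> R) : (forall i, 0 <= k i) -> 0 <= prodR k.
Proof. by move=> k0; apply: big_ind => // *; [lra|apply: Rmult_le_pos]. Qed.

Lemma prodR_le1 n (k : 'I_n -> R) : (forall i, 0 <= k i <= 1) -> 0 <= prodR k <= 1.
Proof.
move=> k01; apply: (big_ind (fun x => 0 <= x <= 1)) => // [|x y hx hy]; first lra.
by split; [apply: Rmult_le_pos; lra | rewrite -(Rmult_1_l 1); apply: Rmult_le_compat; lra].
Qed.

Lemma prodR_mul n (k l : 'I_n -> R) : prodR (fun i => k i * l i) = prodR k * prodR l.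
Proof. exact: big_split. Qed.

Lemma log2_prodR n (k : 'I_n -> R) :
  (forall i, 0 < k i) -> log2 (prodR k) = sumR (fun i => log2 (k i)).
Proof.
move=> k0; suff [] : 0 < prodR k /\ log2 (prodR k) = sumR (fun i => log2 (k i)) by [].
apply: (big_ind2 (fun x y => 0 < x /\ log2 x = y)).
- by rewrite log2_1; split; lra.
- move=> x1 y1 x2 y2 [? <-] [? <-]; rewrite log2M //; split=> //.
  exact: Rmult_lt_0_compat.
- by move=> i _; split.
Qed.

Lemma sum_prodR n (A : finType) (k : 'I_n -> A -> R) :
  sumR (fun a : {ffun 'I_n -> A} => prodR (fun i => k i (a i))) =
  prodR (fun i => sumR (k i)).
Proof. by rewrite /prodR bigA_distr_bigA. Qed.

Lemma prodR1 n : prodR (fun _ : 'I_n => 1) = 1.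
Proof. exact: big1_eq. Qed.

Lemma eq_prodR n (k l : 'I_n -> R) : k =1 l -> prodR k = prodR l.
Proof. by move=> kl; apply: eq_bigr => i _; apply: kl. Qed.

(** Every factor other than the [i]-th sums out to 1, so a function of one coordinate sees only that
    coordinate's law. *)
Lemma sum_prodR_coord n (A : finType) (k : 'I_n -> A -> R) (i : 'I_n) (F : A -> R) :
  (forall j, sumR (k j) = 1) ->
  sumR (fun a : {ffun 'I_n -> A} => prodR (fun j => k j (a j)) * F (a i)) =
  sumR (fun a => k i a * F a).
Proof.
(* [F] is absorbed into the [i]-th factor, which makes the summand a pure product. *)
move=> k1; pose l j a := k j a * if j == i then F a else 1.
transitivity (sumR (fun a : {ffun 'I_n -> A} => prodR (fun j => l j (a j)))).
  apply: eq_sumR => a; rewrite prodR_mul; congr (_ * _).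
  by rewrite /prodR -(big_mkcond (fun j => j == i)) big_pred1_eq.
rewrite sum_prodR /prodR (bigD1 i) //= big1 ?Rmult_1_r.
  by apply: eq_sumR => a; rewrite /l eqxx.
move=> j /negbTE ji; rewrite -(k1 j); apply: eq_sumR => a.
by rewrite /l ji Rmult_1_r.
Qed.

(** * Entropy and conditional entropy *)

Section Entropy.
Variables (T : finType) (P : T -> R).
Hypothesis P0 : forall t, 0 <= P t.

Lemma marg_ge0 (S : finType) (f : T -> S) s : 0 <= marg P f s.
Proof. by apply: sumR_ge0 => t; case: ifP => // _; lra. Qed.

Lemma marg_ge (S : finType) (f : T -> S) t : P t <= marg P f (f t).
Proof.
have := @sumR_ge_term _ (fun t' => if f t' == f t then P t' else 0) t.
by rewrite eqxx; apply=> t'; case: ifP => // _; lra.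
Qed.

(** Change of variables: an expectation may be taken on the sample space or under the law of [f]. *)
Lemma sum_marg (S : finType) (f : T -> S) (F : S -> R) :
  sumR (fun s => marg P f s * F s) = sumR (fun t => P t * F (f t)).
Proof.
under eq_sumR do rewrite /marg -sumR_mulr.
rewrite sumR_exch; apply: eq_sumR => t.
rewrite -(sumR_delta_sym (fun s => P t * F s) (f t)).
by apply: eq_sumR => s; case: ifP => _; rewrite ?Rmult_0_l.
Qed.

Lemma sum_marg1 (S : finType) (f : T -> S) : sumR (marg P f) = sumR P.
Proof.
have := sum_marg f (fun _ => 1); under eq_sumR do rewrite Rmult_1_r.
by move=> ->; apply: eq_sumR => t; rewrite Rmult_1_r.
Qed.

Lemma marg_comp (S S' : finType) (f : T -> S) (h : S -> S') s' :
  marg (marg P f) h s' = marg P (fun t => h (f t)) s'.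
Proof.
have := sum_marg f (fun s => if h s == s' then 1 else 0).
move=> E; transitivity (sumR (fun t => P t * (if h (f t) == s' then 1 else 0))).
  by rewrite -E; apply: eq_sumR => s; case: ifP => _; lra.
by apply: eq_sumR => t; case: ifP => _; lra.
Qed.

(** Values of mass 0 contribute nothing to either sum. Entropy thus becomes an expectation over
    sample points, where different variables can be compared pointwise. *)
Lemma entropyE (S : finType) (f : T -> S) :
  entropy P f = - sumR (fun t => P t * log2 (marg P f (f t))).
Proof.
rewrite /entropy -(sum_marg f (fun s => log2 (marg P f s))); congr (- _).
apply: eq_sumR => s; rewrite /xlog2x; case: Rle_dec => //= h.
by have -> : marg P f s = 0; [have := marg_ge0 f s; lra | lra].
Qed.

(** [g] is a function of [f], so each fibre of [f] lies inside a fibre of [g] and marginal masses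
    only grow. *)
Lemma entropy_mono (A B : finType) (f : T -> A) (g : T -> B) :
  (forall t t', f t = f t' -> g t = g t') -> entropy P g <= entropy P f.
Proof.
move=> fg; rewrite !entropyE; apply: Ropp_le_contravar; apply: sumR_le => t.
have [Pt|Pt] : 0 < P t \/ P t = 0 by have := P0 t; lra.
  apply: Rmult_le_compat_l => //; apply: log2_le.
    by have := marg_ge f t; lra.
  apply: sumR_le => t'; case: eqP => [/fg ->|_]; first by rewrite eqxx; lra.
  by case: ifP => // _; lra.
by rewrite Pt; lra.
Qed.

Lemma entropy_eq (A B : finType) (f : T -> A) (g : T -> B) :
  (forall t t', f t = f t' <-> g t = g t') -> entropy P f = entropy P g.
Proof. by move=> fg; apply: Rle_antisym; apply: entropy_mono => t t' /fg. Qed.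

Lemma entropy_comp (S S' : finType) (f : T -> S) (h : S -> S') :
  entropy P (fun t => h (f t)) = entropy (marg P f) h.
Proof. by congr (- _); apply: eq_sumR => s; rewrite marg_comp. Qed.

Definition condH (A B : finType) (f : T -> A) (g : T -> B) : R :=
  entropy P (pairRV f g) - entropy P g.

(** Evaluates a conditional entropy exactly once a kernel [k] for [f] given [g] is known; [k] has to
    match only on the support of [P]. *)
Lemma condHE (A B : finType) (f : T -> A) (g : T -> B) (k : B -> A -> R) :
  (forall t, 0 < P t ->
     marg P (pairRV f g) (f t, g t) = marg P g (g t) * k (g t) (f t)) ->
  condH f g = - sumR (fun t => P t * log2 (k (g t) (f t))).
Proof.
move=> kE; rewrite /condH !entropyE.
rewrite (eq_sumR (g := fun t => P t * log2 (marg P g (g t)) +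
                               P t * log2 (k (g t) (f t)))).
  by rewrite sumR_add; lra.
move=> t; have [Pt|->] : 0 < P t \/ P t = 0 by have := P0 t; lra.
  have m1 : 0 < marg P (pairRV f g) (f t, g t) by exact: Rlt_le_trans Pt (marg_ge (pairRV f g) t).
  have m2 : 0 < marg P g (g t) by have := marg_ge g t; lra.
  have k0 : 0 < k (g t) (f t).
    by apply: (Rmult_lt_reg_l (marg P g (g t))) => //; rewrite Rmult_0_r -kE.
  by rewrite [pairRV f g t]/pairRV kE // log2M //; lra.
by lra.
Qed.

Lemma condH_pos (A B : finType) (f : T -> A) (g : T -> B) :
  condH f g = - sumR (fun t => P t *
    log2 (marg P (pairRV f g) (f t, g t) / marg P g (g t))).
Proof.
apply: (condHE (k := fun b a => marg P (pairRV f g) (a, b) / marg P g b)) => t Pt.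
by field; have := marg_ge g t; lra.
Qed.

Hypothesis P1 : sumR P = 1.

(** Gibbs' inequality: [ln x <= x - 1] is applied to the ratio [r] of [k] to the true conditional
    law, whose expectation is at most 1. Sub-probability kernels are allowed because [condlaw]
    vanishes where [g] has mass 0. *)
Lemma condH_le_cross (A B : finType) (f : T -> A) (g : T -> B) (k : B -> A -> R) :
  (forall b a, 0 <= k b a) -> (forall b, sumR (k b) <= 1) ->
  (forall t, 0 < P t -> 0 < k (g t) (f t)) ->
  condH f g <= - sumR (fun t => P t * log2 (k (g t) (f t))).
Proof.
move=> k0 k1 ks; rewrite condH_pos.
pose mfg := marg P (pairRV f g); pose mg := marg P g.
pose r a b := k b a * mg b / mfg (a, b).
suff: sumR (fun t => P t * log2 (k (g t) (f t)) +
             - (P t * log2 (mfg (f t, g t) / mg (g t)))) <= 0.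
  by rewrite sumR_add sumR_opp -/mfg -/mg; lra.
apply: (Rle_trans _ (sumR (fun t => / ln 2 * (P t * r (f t) (g t)) + - (/ ln 2 * P t)))).
  apply: sumR_le => t; have [Pt|->] : 0 < P t \/ P t = 0 by have := P0 t; lra.
    have m1 : 0 < mfg (f t, g t) by exact: Rlt_le_trans Pt (marg_ge (pairRV f g) t).
    have m2 : 0 < mg (g t) by have := marg_ge g t; rewrite /mg; lra.
    have kt := ks _ Pt.
    have -> : / ln 2 * (P t * r (f t) (g t)) + - (/ ln 2 * P t) =
              P t * ((r (f t) (g t) - 1) / ln 2) by rewrite /Rdiv; ring.
    have -> : P t * log2 (k (g t) (f t)) + - (P t * log2 (mfg (f t, g t) / mg (g t))) =
              P t * log2 (r (f t) (g t)).
      rewrite /r /Rdiv !log2M ?log2V //; first lra.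
      - exact: Rmult_lt_0_compat.
      - exact: Rinv_0_lt_compat.
      - exact: Rinv_0_lt_compat.
    apply: Rmult_le_compat_l => //; apply: log2_leB1.
    by apply: Rmult_lt_0_compat; [exact: Rmult_lt_0_compat | exact: Rinv_0_lt_compat].
  by lra.
rewrite sumR_add sumR_opp !sumR_mull P1.
have : sumR (fun t => P t * r (f t) (g t)) <= 1.
  rewrite -(sum_marg (pairRV f g) (fun ab => r ab.1 ab.2)) sumR_pair sumR_exch.
  apply: (Rle_trans _ (sumR (fun b => sumR (fun a => k b a) * mg b))).
    apply: sumR_le => b; rewrite -sumR_mulr; apply: sumR_le => a /=.
    have kmg : 0 <= k b a * mg b by apply: Rmult_le_pos => //; exact: marg_ge0.
    (* Pairs of mass 0 drop out on the left but may carry mass of [k]; hence only an inequality. *)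
    rewrite -/mfg /r; have [m|->] : 0 < mfg (a, b) \/ mfg (a, b) = 0.
    - by have := marg_ge0 (pairRV f g) (a, b); rewrite -/mfg; lra.
    - by apply: Req_le; field; lra.
    - by lra.
  rewrite -P1 -(sum_marg1 g); apply: sumR_le => b.
  rewrite -[X in _ <= X]Rmult_1_l; apply: Rmult_le_compat_r => //; exact: marg_ge0.
by have := Rinv_0_lt_compat _ ln2_gt0; nra.
Qed.

Lemma marg_pair_le (A B : finType) (f : T -> A) (g : T -> B) a b :
  marg P (pairRV f g) (a, b) <= marg P g b.
Proof.
apply: sumR_le => t; rewrite xpair_eqE; case: (f t == a) => /=; first lra.
by case: ifP => // _; lra.
Qed.

Lemma sum_marg_pair (A B : finType) (f : T -> A) (g : T -> B) b :
  sumR (fun a => marg P (pairRV f g) (a, b)) = marg P g b.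
Proof.
rewrite sumR_exch; apply: eq_sumR => t.
rewrite -[RHS](sumR_delta_sym (fun _ => if g t == b then P t else 0) (f t)).
by apply: eq_sumR => a; rewrite xpair_eqE; case: (f t == a).
Qed.

(* Junk value: [0] where [g] has mass [0]. *)
Definition condlaw (A B : finType) (f : T -> A) (g : T -> B) (b : B) (a : A) :=
  marg P (pairRV f g) (a, b) / marg P g b.

Lemma condlaw_ge0 (A B : finType) (f : T -> A) (g : T -> B) b a :
  0 <= condlaw f g b a.
Proof.
have [m|m] : 0 < marg P g b \/ marg P g b = 0 by have := marg_ge0 g b; lra.
  apply: Rmult_le_pos; first exact: marg_ge0.
  by apply/Rlt_le/Rinv_0_lt_compat.
have m0 : marg P (pairRV f g) (a, b) = 0.
  by have := marg_pair_le f g a b; have := marg_ge0 (pairRV f g) (a, b); lra.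
by rewrite /condlaw m0 /Rdiv; lra.
Qed.

Lemma condlaw_le1 (A B : finType) (f : T -> A) (g : T -> B) b :
  0 <= sumR (condlaw f g b) <= 1.
Proof.
split; first by apply: sumR_ge0 => a; exact: condlaw_ge0.
rewrite /condlaw /Rdiv sumR_mulr sum_marg_pair.
have [m|->] : 0 < marg P g b \/ marg P g b = 0 by have := marg_ge0 g b; lra.
  by rewrite Rinv_r; lra.
by lra.
Qed.

Lemma condlaw_gt0 (A B : finType) (f : T -> A) (g : T -> B) t :
  0 < P t -> 0 < condlaw f g (g t) (f t).
Proof.
move=> Pt; apply: Rmult_lt_0_compat.
  by exact: Rlt_le_trans Pt (marg_ge (pairRV f g) t).
by apply: Rinv_0_lt_compat; have := marg_ge g t; lra.
Qed.

Lemma condH_condlaw (A B : finType) (f : T -> A) (g : T -> B) :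
  condH f g = - sumR (fun t => P t * log2 (condlaw f g (g t) (f t))).
Proof. exact: condH_pos. Qed.

(** Gibbs' inequality, with the law of [f] given [h] alone as the comparison kernel. *)
Lemma condH_cond_le (A B C : finType) (f : T -> A) (g : T -> B) (h : T -> C) :
  condH f (pairRV g h) <= condH f h.
Proof.
rewrite [X in _ <= X]condH_condlaw.
apply: (condH_le_cross (k := fun bc a => condlaw f h bc.2 a)).
- by move=> bc a; exact: condlaw_ge0.
- by move=> bc; case: (condlaw_le1 f h bc.2).
- by move=> t Pt; exact: condlaw_gt0.
Qed.

Lemma entropy_const (A : finType) (a : A) : entropy P (fun _ => a) = 0.
Proof.
rewrite entropyE; rewrite (eq_sumR (g := fun t => P t * 0)).
  by rewrite sumR_mulr; lra.
move=> t; rewrite (_ : marg _ _ _ = 1) ?log2_1 // -P1.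
by apply: eq_sumR => t'; rewrite eqxx.
Qed.

Lemma entropy_condH_const (A B : finType) (f : T -> A) (b : B) :
  condH f (fun _ => b) = entropy P f.
Proof.
rewrite /condH entropy_const Rminus_0_r; apply: entropy_eq => t t'.
by rewrite /pairRV; split=> [[]|->].
Qed.

Lemma entropy_subadd (A B : finType) (f : T -> A) (g : T -> B) :
  entropy P (pairRV f g) <= entropy P f + entropy P g.
Proof.
have := condH_cond_le f g (fun _ => tt); rewrite entropy_condH_const /condH.
rewrite (entropy_eq (f := pairRV f _) (g := pairRV f g)).
  rewrite (entropy_eq (f := pairRV g _) (g := g)); first lra.
  by move=> t t'; rewrite /pairRV; split=> [[]|->].
by move=> t t'; rewrite /pairRV; split=> [[-> ->]|[-> ->]].
Qed.

Lemma condH_swap (A B : finType) (f : T -> A) (g : T -> B) :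
  entropy P f + condH g f = entropy P g + condH f g.
Proof.
rewrite /condH (entropy_eq (f := pairRV g f) (g := pairRV f g)); first lra.
by move=> t t'; rewrite /pairRV; split=> [[-> ->]|[-> ->]].
Qed.

Lemma entropy_le_condH (A B : finType) (f : T -> A) (g : T -> B) :
  entropy P f <= entropy P g + condH f g.
Proof.
have : entropy P f <= entropy P (pairRV f g) by apply: entropy_mono => t t' [].
by rewrite /condH; lra.
Qed.

Section SplitPair.
Variables (A B C : finType) (f : T -> A) (g : T -> B) (h : T -> C).
(** Stated through fibres, because a block of pairs and a pair of blocks have different types. *)
Hypothesis split_f : forall t t', f t = f t' <-> g t = g t' /\ h t = h t'.

Lemma entropy_split : entropy P f <= entropy P g + entropy P h.
Proof.
rewrite (entropy_eq (g := pairRV g h)); first exact: entropy_subadd.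
by move=> t t'; rewrite split_f /pairRV; split=> [[-> ->]|[-> ->]].
Qed.

(* This is [I(g;h|u) >= 0]. *)
Lemma entropy_submod (U : finType) (u : T -> U) :
  entropy P f + condH u f + entropy P u <=
  (entropy P g + condH u g) + (entropy P h + condH u h).
Proof.
(* [H(g) + H(u|g)] becomes [H(u) + H(g|u)], likewise for [h]; what remains is
   [H(g|h,u) <= H(g|u)]. *)
rewrite (condH_swap g u) (condH_swap h u).
have := condH_cond_le g h u; rewrite /condH.
rewrite (entropy_eq (f := pairRV g (pairRV h u)) (g := pairRV u f)); first lra.
move=> t t'; rewrite /pairRV; split=> [[E1 E2 ->]|[-> /split_f[-> ->]]] //.
by congr (_, _); apply/split_f.
Qed.

End SplitPair.

End Entropy.

(** * Markov chains X - Y - U *)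

Definition indic (b : bool) : R := if b then 1 else 0.

Lemma indic_and b c : indic (b && c) = indic b * indic c.
Proof. by case: b; case: c; rewrite /indic /=; lra. Qed.

Lemma margE (T S : finType) (P : T -> R) (f : T -> S) s :
  marg P f s = sumR (fun t => P t * indic (f t == s)).
Proof. by apply: eq_sumR => t; rewrite /indic; case: ifP => _; lra. Qed.

Lemma sum_indic (T : finType) (F : T -> R) a :
  sumR (fun x => F x * indic (x == a)) = F a.
Proof.
rewrite -[RHS](sumR_delta F); apply: eq_sumR => x.
by rewrite /indic; case: ifP => _; lra.
Qed.

(** If the law of [f] given [w] depends on [w] only through [h], summing over the fibres of [h]
    shows that it is also the law given [h] of [w]. *)
Lemma marg_kernel (T A B C : finType) (P : T -> R) (f : T -> A) (w : T -> B)
    (h : B -> C) (k : C -> A -> R) :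
  (forall a b, marg P (pairRV f w) (a, b) = marg P w b * k (h b) a) ->
  forall a c, marg P (pairRV f (fun t => h (w t))) (a, c) =
              marg P (fun t => h (w t)) c * k c a.
Proof.
move=> kE a c.
rewrite -(marg_comp P w h) -(marg_comp P (pairRV f w) (fun ab => (ab.1, h ab.2))).
rewrite !margE -sumR_mulr sumR_pair sumR_exch; apply: eq_sumR => b.
transitivity (sumR (fun x => marg P w b * k (h b) x * indic (h b == c) * indic (x == a))).
  by apply: eq_sumR => x; rewrite kE xpair_eqE indic_and /=; ring.
rewrite sum_indic /indic; case: eqP => [->|_]; ring.
Qed.

Section ChainLaw.
Variables (X Y U : finType) (mu : X -> R) (K : X -> Y -> R) (L : Y -> U -> R).

(** Serves both for one letter, with the input pair as X, and for a whole block, with the message as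
    X. *)
Definition chain_law (t : X * Y * U) : R := mu t.1.1 * K t.1.1 t.1.2 * L t.1.2 t.2.

(** The nested order lets the kernels be summed out from the inside. *)
Lemma sum_chain_law (F : X * Y * U -> R) :
  sumR (fun t => chain_law t * F t) =
  sumR (fun a => mu a * sumR (fun b => K a b * sumR (fun c => L b c * F (a, b, c)))).
Proof.
rewrite sumR_pair sumR_pair; apply: eq_sumR => a; rewrite -sumR_mull.
apply: eq_sumR => b; rewrite -Rmult_assoc -sumR_mull.
by apply: eq_sumR => c; rewrite /chain_law /=; ring.
Qed.

Hypothesis mu_pmf : is_pmf mu.
Hypothesis K_pmf : forall a, is_pmf (K a).
Hypothesis L_pmf : forall b, is_pmf (L b).

Lemma chain_law_pmf : is_pmf chain_law.
Proof.
split=> [t|].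
  apply: Rmult_le_pos; last by case: (L_pmf t.1.2).
  by apply: Rmult_le_pos; [case: mu_pmf | case: (K_pmf t.1.1)].
have := sum_chain_law (fun _ => 1); under eq_sumR do rewrite Rmult_1_r.
move=> ->; rewrite -[RHS](proj2 mu_pmf); apply: eq_sumR => a.
transitivity (mu a * sumR (K a)); last by rewrite (proj2 (K_pmf a)) Rmult_1_r.
congr (_ * _); apply: eq_sumR => b.
by rewrite sumR_mulr (proj2 (L_pmf b)); ring.
Qed.

Let P0 := proj1 chain_law_pmf.

Lemma marg_chain_law_x a : marg chain_law (fun t => t.1.1) a = mu a.
Proof.
rewrite margE sum_chain_law -[RHS](sum_indic mu); apply: eq_sumR => a' /=.
congr (_ * _); rewrite -[RHS]Rmult_1_l -(proj2 (K_pmf a')) -sumR_mulr.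
apply: eq_sumR => b; congr (_ * _).
by rewrite sumR_mulr (proj2 (L_pmf b)) Rmult_1_l.
Qed.

Lemma marg_chain_law_yx b a :
  marg chain_law (pairRV (fun t => t.1.2) (fun t => t.1.1)) (b, a) = mu a * K a b.
Proof.
rewrite margE sum_chain_law -[RHS](sum_indic (fun a => mu a * K a b)).
apply: eq_sumR => a'; rewrite /pairRV /= Rmult_assoc -(sum_indic (K a')) -sumR_mulr.
congr (_ * _); apply: eq_sumR => b'; rewrite Rmult_assoc; congr (_ * _).
by rewrite sumR_mulr (proj2 (L_pmf b')) Rmult_1_l -indic_and.
Qed.

Lemma marg_chain_law_ux c a :
  marg chain_law (pairRV (fun t => t.2) (fun t => t.1.1)) (c, a) =
  mu a * sumR (fun b => K a b * L b c).
Proof.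
rewrite margE sum_chain_law.
rewrite -[RHS](sum_indic (fun a => mu a * sumR (fun b => K a b * L b c))).
apply: eq_sumR => a'; rewrite /pairRV /= Rmult_assoc -sumR_mulr.
congr (_ * _); apply: eq_sumR => b; rewrite Rmult_assoc; congr (_ * _).
rewrite -(sum_indic (L b)) -sumR_mulr; apply: eq_sumR => c'.
by rewrite xpair_eqE indic_and; ring.
Qed.

Lemma marg_chain_law_xyu (S : finType) (f : X * Y * U -> S) t :
  injective f -> marg chain_law f (f t) = chain_law t.
Proof.
move=> fI; rewrite -[RHS](sumR_delta chain_law); apply: eq_sumR => t'.
by rewrite (inj_eq fI).
Qed.

Lemma marg_chain_law_xy a b : marg chain_law (fun t => t.1) (a, b) = mu a * K a b.
Proof.
rewrite -marg_chain_law_yx; apply: eq_sumR => -[[a' b'] c] /=.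
by rewrite !xpair_eqE andbC.
Qed.

Variables (Z : finType) (h : X -> Z) (KZ : Z -> Y -> R).
(** The channel sees X only through [h]: for a block, [h] can send a message to its codewords;
    otherwise it is taken to be the identity. *)
Hypothesis KE : forall a b, K a b = KZ (h a) b.

Lemma condH_chain_law_yz :
  condH chain_law (fun t => t.1.2) (fun t => h t.1.1) =
  - sumR (fun t => chain_law t * log2 (KZ (h t.1.1) t.1.2)).
Proof.
apply: (condHE P0 (k := KZ)) => t _.
apply: (marg_kernel (w := fun t : X * Y * U => t.1.1)) => b a.
by rewrite marg_chain_law_yx marg_chain_law_x KE.
Qed.

Lemma condH_chain_law_uz :
  condH chain_law (fun t => t.2) (fun t => h t.1.1) =
  - sumR (fun t => chain_law t * log2 (sumR (fun b => KZ (h t.1.1) b * L b t.2))).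
Proof.
apply: (condHE P0 (k := fun z c => sumR (fun b => KZ z b * L b c))) => t _.
apply: (marg_kernel (w := fun t : X * Y * U => t.1.1)
                    (k := fun z c => sumR (fun b => KZ z b * L b c))) => b a.
rewrite marg_chain_law_ux marg_chain_law_x; congr (_ * _).
by apply: eq_sumR => b'; rewrite KE.
Qed.

Lemma condH_chain_law_uy :
  condH chain_law (fun t => t.2) (fun t => t.1.2) =
  - sumR (fun t => chain_law t * log2 (L t.1.2 t.2)).
Proof.
apply: (condHE P0) => t _.
(* Given the pair of X and Y the law of U is [L], which reads only Y. *)
apply: (marg_kernel (w := fun t : X * Y * U => t.1) (h := snd)) => c [a b].
rewrite marg_chain_law_xy.
apply: (marg_chain_law_xyu (f := pairRV snd (fun t => t.1)) (a, b, c)).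
by move=> [[? ?] ?] [[? ?] ?] [-> -> ->].
Qed.

(** Together with the formulas for [H(Y|X)] and [H(U|Y)] this is [H(YU|X) = H(Y|X) + H(U|Y)], the
    form in which the Markov property enters [I(X;Y|U)]. *)
Lemma condH_chain_law_yux :
  condH chain_law (pairRV (fun t => t.1.2) (fun t => t.2)) (fun t => t.1.1) =
  - sumR (fun t => chain_law t * log2 (K t.1.1 t.1.2)) +
  - sumR (fun t => chain_law t * log2 (L t.1.2 t.2)).
Proof.
rewrite (condHE P0 (k := fun a bc => K a bc.1 * L bc.1 bc.2)) => [|t _].
  rewrite -Ropp_plus_distr -sumR_add; congr (- _); apply: eq_sumR => t /=.
  (* Where a factor is 0 the logarithm need not split, but there the weight vanishes as well. *)
  have [Pt|->] : 0 < chain_law t \/ chain_law t = 0 by have := P0 t; lra.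
    have K0 := proj1 (K_pmf t.1.1) t.1.2; have L0 := proj1 (L_pmf t.1.2) t.2.
    have [k0|k0] : 0 < K t.1.1 t.1.2 \/ K t.1.1 t.1.2 = 0 by lra.
      have [l0|l0] : 0 < L t.1.2 t.2 \/ L t.1.2 t.2 = 0 by lra.
        by rewrite log2M //; ring.
      by move: Pt; rewrite /chain_law l0; lra.
    by move: Pt; rewrite /chain_law k0; lra.
  by ring.
rewrite marg_chain_law_x.
rewrite (marg_chain_law_xyu (f := pairRV (pairRV (fun t => t.1.2) snd) (fun t => t.1.1)) t).
  by rewrite /chain_law /=; ring.
by move=> [[? ?] ?] [[? ?] ?] [-> -> ->].
Qed.

End ChainLaw.

(** * From blocks to letters *)

Lemma Rmult_gt0_factors a b c : 0 <= a -> 0 <= b -> 0 <= c -> 0 < a * b * c ->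
  [/\ 0 < a, 0 < b & 0 < c].
Proof.
move=> [a0|<-] [b0|<-] [c0|<-]; rewrite ?(Rmult_0_l, Rmult_0_r); try lra.
by split.
Qed.

(** Memoryless use of [k]. The input is a plain function, so that it can be [xs w] or a finite
    function. *)
Definition block_kernel (A B : finType) (k : A -> B -> R) (n : nat) (a : 'I_n -> A)
  (b : {ffun 'I_n -> B}) : R := prodR (fun i => k (a i) (b i)).

Lemma block_kernel_pmf (A B : finType) (k : A -> B -> R) n (a : 'I_n -> A) :
  (forall x, is_pmf (k x)) -> is_pmf (block_kernel k a).
Proof.
move=> kP; split=> [b|]; first by apply: prodR_ge0 => i; case: (kP (a i)).
rewrite (sum_prodR (fun i => k (a i))) -[RHS](prodR1 n); apply: eq_prodR => i.
by case: (kP (a i)).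
Qed.

Section Block.
Variables (X Y U I : finType) (mu : I -> R) (V : X -> Y -> R) (q : Y -> U -> R).
Variables (n : nat) (xs : I -> 'I_n -> X).
Hypothesis n_gt0 : leq 1 n.
Hypothesis mu_pmf : is_pmf mu.
Hypothesis V_pmf : forall x, is_pmf (V x).
Hypothesis q_pmf : forall y, is_pmf (q y).

(** The law of the input at a uniformly random time. It involves neither [q] nor [U], so one input
    law serves every auxiliary channel. *)
Definition avg_law (x : X) : R := / INR n * sumR (fun i => marg mu (fun w => xs w i) x).

Definition letter_law := chain_law avg_law V q.
(** The chain starts at the message index; the codewords are functions of it through [xs]. *)
Definition block_law := chain_law mu (fun w => block_kernel V (xs w))
  (fun y : {ffun 'I_n -> Y} => block_kernel q y).

Definition letter (w : I * {ffun 'I_n -> Y} * {ffun 'I_n -> U}) (i : 'I_n) : X * Y * U :=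
  (xs w.1.1 i, w.1.2 i, w.2 i).

Definition letterwise (A : finType) (f : X * Y * U -> A) w : {ffun 'I_n -> A} :=
  [ffun i => f (letter w i)].

Let n_R : 0 < INR n. Proof. exact/lt_0_INR/ltP. Qed.

Lemma block_law_pmf : is_pmf block_law.
Proof. by apply: chain_law_pmf => // *; apply: block_kernel_pmf. Qed.

Lemma avg_law_pmf : is_pmf avg_law.
Proof.
split=> [x|].
  apply: Rmult_le_pos; first exact/Rlt_le/Rinv_0_lt_compat.
  by apply: sumR_ge0 => i; apply: marg_ge0; case: mu_pmf.
rewrite sumR_mull sumR_exch.
rewrite (eq_sumR (g := fun _ => 1)) => [|i]; last first.
  by rewrite sum_marg1; case: mu_pmf.
by rewrite sumR_const Rmult_1_r Rinv_l; lra.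
Qed.

Lemma letter_law_pmf : is_pmf letter_law.
Proof. by apply: chain_law_pmf => //; apply: avg_law_pmf. Qed.

Lemma sum_block_law_letter (F : X * Y * U -> R) i :
  sumR (fun w => block_law w * F (letter w i)) =
  sumR (fun w => mu w * sumR (fun b => V (xs w i) b *
    sumR (fun c => q b c * F (xs w i, b, c)))).
Proof.
rewrite sum_chain_law; apply: eq_sumR => w; congr (_ * _).
have q1 b : sumR (q b) = 1 by case: (q_pmf b).
rewrite -(sum_prodR_coord (k := fun j => V (xs w j)) i); last first.
  by move=> j; case: (V_pmf (xs w j)).
apply: eq_sumR => y; congr (_ * _).
by rewrite -(sum_prodR_coord (k := fun j => q (y j)) i (fun c => F (xs w i, y i, c))).
Qed.

(** The core of single-letterization: averaging the input law and averaging over time give the same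
    expectation. *)
Lemma sum_letter_law (F : X * Y * U -> R) :
  sumR (fun t => letter_law t * F t) =
  / INR n * sumR (fun i => sumR (fun w => block_law w * F (letter w i))).
Proof.
rewrite sum_chain_law; under eq_sumR do rewrite Rmult_assoc.
rewrite sumR_mull; congr (_ * _).
under eq_sumR do rewrite -sumR_mulr.
rewrite sumR_exch; apply: eq_sumR => i; rewrite sum_block_law_letter.
exact: (sum_marg mu (fun w => xs w i)).
Qed.

(** Guarantees that, on the support of the block law, logarithms of single-letter kernels are taken
    at positive numbers. *)
Lemma letter_law_gt0 w i : 0 < block_law w -> 0 < letter_law (letter w i).
Proof.
(* The mass is the expectation of an indicator; one summand of its time average is already
   positive. *)
move=> Pw; rewrite -(sum_indic letter_law) sum_letter_law.
have [B0 _] := block_law_pmf.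
apply: Rmult_lt_0_compat; first exact: Rinv_0_lt_compat.
have indic0 b : 0 <= indic b by case: b; rewrite /indic; lra.
apply: Rlt_le_trans Pw _.
apply: Rle_trans (sumR_ge_term i _); last first.
  by move=> j; apply: sumR_ge0 => w'; apply: Rmult_le_pos.
apply: Rle_trans (sumR_ge_term w _); last by move=> w'; apply: Rmult_le_pos.
by rewrite eqxx /indic; lra.
Qed.

Lemma sum_block_law_log2 (k : X * Y * U -> R) :
  (forall t, 0 < letter_law t -> 0 < k t) ->
  sumR (fun w => block_law w * log2 (prodR (fun i => k (letter w i)))) =
  INR n * sumR (fun t => letter_law t * log2 (k t)).
Proof.
move=> k0; rewrite (sum_letter_law (fun t => log2 (k t))) -Rmult_assoc Rinv_r; last by lra.
rewrite Rmult_1_l sumR_exch; apply: eq_sumR => w; rewrite sumR_mull.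
have [B0 _] := block_law_pmf.
have [Pw|->] : 0 < block_law w \/ block_law w = 0 by have := B0 w; lra.
  by rewrite log2_prodR // => i; apply/k0/letter_law_gt0.
by rewrite !Rmult_0_l.
Qed.

(* Comparing with the product of the averaged single-letter conditional laws yields
   subadditivity over time and concavity in the input law in one stroke. *)
Lemma condH_letterwise (A B : finType) (f : X * Y * U -> A) (g : X * Y * U -> B) :
  condH block_law (letterwise f) (letterwise g) <= INR n * condH letter_law f g.
Proof.
have [B0 B1] := block_law_pmf; have [L0 L1] := letter_law_pmf.
pose k := condlaw letter_law f g.
have kp : forall t, 0 < letter_law t -> 0 < k (g t) (f t) by move=> t; apply: condlaw_gt0.
have E w : block_kernel k (letterwise g w) (letterwise f w) =
           prodR (fun i => k (g (letter w i)) (f (letter w i))).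
  by apply: eq_prodR => i; rewrite !ffunE.
apply: (Rle_trans _ (- sumR (fun w => block_law w *
  log2 (block_kernel k (letterwise g w) (letterwise f w))))).
  apply: (condH_le_cross B0 B1 (k := fun b : {ffun 'I_n -> B} => block_kernel k b)).
  - by move=> b a; apply: prodR_ge0 => i; apply: condlaw_ge0.
  - move=> b; rewrite (sum_prodR (fun i => k (b i))).
    by apply: (proj2 (prodR_le1 _)) => i; apply: condlaw_le1.
  - by move=> w Pw; rewrite E; apply: prodR_gt0 => i; apply/kp/letter_law_gt0.
under eq_sumR do rewrite E.
rewrite (sum_block_law_log2 (k := fun t => k (g t) (f t))) // condH_condlaw //.
by rewrite /k; lra.
Qed.

Lemma entropy_letterwise (A : finType) (f : X * Y * U -> A) :
  entropy block_law (letterwise f) <= INR n * entropy letter_law f.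
Proof.
have [B0 B1] := block_law_pmf; have [L0 L1] := letter_law_pmf.
have := condH_letterwise f (fun _ => tt); rewrite (entropy_condH_const L0 L1 f tt).
have -> : letterwise (fun _ => tt) = fun _ => [ffun _ => tt].
  by apply: functional_extensionality => w; apply/ffunP => i; rewrite !ffunE.
by rewrite entropy_condH_const.
Qed.

Let x_ (t : X * Y * U) := t.1.1.
Let y_ (t : X * Y * U) := t.1.2.
Let u_ (t : X * Y * U) := t.2.

Lemma letterwise_y : letterwise y_ = fun w => w.1.2.
Proof. by apply: functional_extensionality => w; apply/ffunP => i; rewrite ffunE. Qed.

Lemma letterwise_u : letterwise u_ = fun w => w.2.
Proof. by apply: functional_extensionality => w; apply/ffunP => i; rewrite ffunE. Qed.

Lemma letter_law_factors t : 0 < letter_law t ->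
  0 < V t.1.1 t.1.2 /\ 0 < q t.1.2 t.2.
Proof.
case/Rmult_gt0_factors => //; first exact: (proj1 avg_law_pmf).
- by case: (V_pmf t.1.1).
- by case: (q_pmf t.1.2).
Qed.

(** Equality, because for a memoryless channel the law of [Y^n] given [X^n] is itself a product of
    letter kernels. *)
Lemma condH_letterwise_yx :
  condH block_law (letterwise y_) (letterwise x_) = INR n * condH letter_law y_ x_.
Proof.
rewrite letterwise_y.
rewrite (condH_chain_law_yz mu_pmf _ _ (h := fun w => [ffun i => xs w i])
  (KZ := fun z : {ffun 'I_n -> X} => block_kernel V z)); last first.
- by move=> w y; apply: eq_prodR => i; rewrite ffunE.
- by move=> y; apply: block_kernel_pmf.
- by move=> w; apply: block_kernel_pmf.
rewrite (condH_chain_law_yz avg_law_pmf V_pmf q_pmf (h := fun x => x) (KZ := V)) //.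
rewrite -[RHS]Ropp_mult_distr_r; congr (- _).
rewrite -(sum_block_law_log2 (k := fun t => V t.1.1 t.1.2)).
  apply: eq_sumR => w; congr (_ * log2 _).
  by apply: eq_prodR => i; rewrite ffunE.
by move=> t /letter_law_factors[].
Qed.

Lemma condH_letterwise_ux :
  condH block_law (letterwise u_) (letterwise x_) = INR n * condH letter_law u_ x_.
Proof.
rewrite letterwise_u.
rewrite (condH_chain_law_uz mu_pmf _ _ (h := fun w => [ffun i => xs w i])
  (KZ := fun z : {ffun 'I_n -> X} => block_kernel V z)); last first.
- by move=> w y; apply: eq_prodR => i; rewrite ffunE.
- by move=> y; apply: block_kernel_pmf.
- by move=> w; apply: block_kernel_pmf.
rewrite (condH_chain_law_uz avg_law_pmf V_pmf q_pmf (h := fun x => x) (KZ := V)) //.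
rewrite -[RHS]Ropp_mult_distr_r; congr (- _).
rewrite -(sum_block_law_log2 (k := fun t => sumR (fun b => V t.1.1 b * q b t.2))).
  apply: eq_sumR => w; congr (_ * log2 _).
  (* The channel from [X^n] to [U^n] is memoryless too: a sum over [y^n] of products is a product of
     sums. *)
  rewrite -(sum_prodR (fun i b => V (xs w.1.1 i) b * q b (w.2 i))).
  apply: eq_sumR => y; rewrite prodR_mul; congr (_ * _).
  by apply: eq_prodR => i; rewrite ffunE.
move=> t /letter_law_factors[V0 q0].
apply: Rlt_le_trans (Rmult_lt_0_compat _ _ V0 q0) _.
apply: (sumR_ge_term (f := fun b => V t.1.1 b * q b t.2)) => b.
by apply: Rmult_le_pos; [case: (V_pmf t.1.1) | case: (q_pmf b)].
Qed.

Lemma condH_letterwise_uy :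
  condH block_law (letterwise u_) (letterwise y_) = INR n * condH letter_law u_ y_.
Proof.
rewrite letterwise_u letterwise_y.
rewrite (condH_chain_law_uy mu_pmf); last first.
- by move=> y; apply: block_kernel_pmf.
- by move=> w; apply: block_kernel_pmf.
rewrite (condH_chain_law_uy avg_law_pmf V_pmf q_pmf).
rewrite -[RHS]Ropp_mult_distr_r; congr (- _).
rewrite -(sum_block_law_log2 (k := fun t => q t.1.2 t.2)) //.
by move=> t /letter_law_factors[].
Qed.

(** The codewords are functions of the message and determine the law of [Y^n], so both sides are the
    same expected logarithm. *)
Lemma condH_message :
  condH block_law (fun w => w.1.2) (fun w => w.1.1) =
  condH block_law (letterwise y_) (letterwise x_).
Proof.
rewrite letterwise_y.
rewrite (condH_chain_law_yz mu_pmf _ _ (h := fun w => [ffun i => xs w i])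
  (KZ := fun z : {ffun 'I_n -> X} => block_kernel V z)); last first.
- by move=> w y; apply: eq_prodR => i; rewrite ffunE.
- by move=> y; apply: block_kernel_pmf.
- by move=> w; apply: block_kernel_pmf.
rewrite (condH_chain_law_yz mu_pmf _ _ (h := fun x => x)
  (KZ := fun w => block_kernel V (xs w))) //.
- congr (- _); apply: eq_sumR => w; congr (_ * log2 _).
  by apply: eq_prodR => i; rewrite ffunE.
- by move=> w; apply: block_kernel_pmf.
- by move=> y; apply: block_kernel_pmf.
Qed.

End Block.

(** * The five terms of the bound for one code *)

(* Names a real, also where it occurs with convertible but distinct implicit arguments. *)
Ltac name_real e :=
  let r := fresh "r" in
  case: (ex_intro (fun r => r = e) e erefl) => r;
  let H := fresh in intro H;
  match goal with E : r = _ |- _ => rewrite -!E; clear E end.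

Ltac split_congr := split; case=> *; congruence.

(** Expands each mutual information into entropies of Y and conditional entropies of Y and U, the
    quantities that pass from block to letter. The fifth hypothesis is doubled to clear the factor
    [/ 2]. *)
Lemma diamond_bound_glb (X1 X2 Y U : finType) (C1 C2 c : R)
    (W : X1 -> X2 -> Y -> R) (px : X1 * X2 -> R) (q : Y -> U -> R) :
  (forall x1 x2, is_pmf (W x1 x2)) -> is_pmf px -> (forall y, is_pmf (q y)) ->
  let P := chain_law px (fun x => W x.1 x.2) q in
  let x := fun t : X1 * X2 * Y * U => t.1.1 in
  let x1 := fun t : X1 * X2 * Y * U => t.1.1.1 in
  let x2 := fun t : X1 * X2 * Y * U => t.1.1.2 in
  let y := fun t : X1 * X2 * Y * U => t.1.2 in
  let u := fun t : X1 * X2 * Y * U => t.2 in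
  c <= C1 + C2 ->
  c <= C1 + (condH P y x1 - condH P y x) ->
  c <= C2 + (condH P y x2 - condH P y x) ->
  c <= entropy P y - condH P y x ->
  2 * c <= C1 + C2 + (condH P y u - condH P y x - condH P u y
                      + condH P u x1 + condH P u x2 - condH P u x) ->
  c <= diamond_bound C1 C2 W px q.
Proof.
move=> W_pmf px_pmf q_pmf P x x1 x2 y u c1 c2 c3 c4 c5.
have V_pmf : forall x : X1 * X2, is_pmf (W x.1 x.2) by move=> [].
have [P0 _] : is_pmf P by apply: chain_law_pmf.
(* Needed for [I(X;Y|U) = H(Y|U) - H(YU|X) + H(U|X)]. *)
have Hyux : condH P (pairRV y u) x = condH P y x + condH P u y.
  rewrite (condH_chain_law_yux px_pmf V_pmf q_pmf) (condH_chain_law_uy px_pmf V_pmf q_pmf).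
  by rewrite (condH_chain_law_yz px_pmf V_pmf q_pmf (h := fun x => x)
    (KZ := fun x => W x.1 x.2)).
have PE : (fun t : X1 * X2 * Y * U =>
  px (t.1.1.1, t.1.1.2) * W t.1.1.1 t.1.1.2 t.1.2 * q t.1.2 t.2) = P.
  by apply: functional_extensionality => -[[[? ?] ?] ?].
rewrite /diamond_bound PE -/x1 -/x2 -/y -/u; move: c1 c2 c3 c4 c5 Hyux.
(* The next nine equalities only regroup or permute coordinates. *)
have e12 : entropy P (pairRV x1 x2) = entropy P x.
  by apply: (entropy_eq P0) => -[[[? ?] ?] ?] [[[? ?] ?] ?]; rewrite /pairRV /x1 /x2 /x /y /u /=; split_congr.
have e21 : entropy P (pairRV x2 x1) = entropy P x.
  by apply: (entropy_eq P0) => -[[[? ?] ?] ?] [[[? ?] ?] ?]; rewrite /pairRV /x1 /x2 /x /y /u /=; split_congr.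
have e2y1 : entropy P (pairRV (pairRV x2 y) x1) = entropy P (pairRV y x).
  by apply: (entropy_eq P0) => -[[[? ?] ?] ?] [[[? ?] ?] ?]; rewrite /pairRV /x1 /x2 /x /y /u /=; split_congr.
have e1y2 : entropy P (pairRV (pairRV x1 y) x2) = entropy P (pairRV y x).
  by apply: (entropy_eq P0) => -[[[? ?] ?] ?] [[[? ?] ?] ?]; rewrite /pairRV /x1 /x2 /x /y /u /=; split_congr.
have e12y : entropy P (pairRV (pairRV x1 x2) y) = entropy P (pairRV y x).
  by apply: (entropy_eq P0) => -[[[? ?] ?] ?] [[[? ?] ?] ?]; rewrite /pairRV /x1 /x2 /x /y /u /=; split_congr.
have e12u : entropy P (pairRV (pairRV x1 x2) u) = entropy P (pairRV u x).
  by apply: (entropy_eq P0) => -[[[? ?] ?] ?] [[[? ?] ?] ?]; rewrite /pairRV /x1 /x2 /x /y /u /=; split_congr.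
have e1u2 : entropy P (pairRV (pairRV x1 u) x2) = entropy P (pairRV u x).
  by apply: (entropy_eq P0) => -[[[? ?] ?] ?] [[[? ?] ?] ?]; rewrite /pairRV /x1 /x2 /x /y /u /=; split_congr.
have e2u1 : entropy P (pairRV (pairRV x2 u) x1) = entropy P (pairRV u x).
  by apply: (entropy_eq P0) => -[[[? ?] ?] ?] [[[? ?] ?] ?]; rewrite /pairRV /x1 /x2 /x /y /u /=; split_congr.
have e12yu : entropy P (pairRV (pairRV (pairRV x1 x2) y) u) =
             entropy P (pairRV (pairRV y u) x).
  by apply: (entropy_eq P0) => -[[[? ?] ?] ?] [[[? ?] ?] ?]; rewrite /pairRV /x1 /x2 /x /y /u /=; split_congr.

rewrite /mi /cmi /condH e12 e21 e2y1 e1y2 e12y e12u e1u2 e2u1 e12yu.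
name_real (entropy P x); name_real (entropy P x1); name_real (entropy P x2).
name_real (entropy P y); name_real (entropy P u).
name_real (entropy P (pairRV y x)); name_real (entropy P (pairRV y x1)).
name_real (entropy P (pairRV y x2)); name_real (entropy P (pairRV y u)).
name_real (entropy P (pairRV u x)); name_real (entropy P (pairRV u x1)).
name_real (entropy P (pairRV u x2)); name_real (entropy P (pairRV u y)).
name_real (entropy P (pairRV (pairRV y u) x)).
by move=> c1 c2 c3 c4 c5 Hyux; repeat apply: Rmin_glb; lra.
Qed.

Section BlockDiamond.
Variables (X1 X2 Y U I : finType) (mu : I -> R) (W : X1 -> X2 -> Y -> R) (q : Y -> U -> R).
Variables (n : nat) (xs : I -> 'I_n -> X1 * X2).
Hypothesis n_gt0 : leq 1 n.
Hypothesis mu_pmf : is_pmf mu.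
Hypothesis W_pmf : forall x1 x2, is_pmf (W x1 x2).
Hypothesis q_pmf : forall y, is_pmf (q y).

Let V (x : X1 * X2) : Y -> R := W x.1 x.2.
Let B := block_law mu V q xs.

(** Mutual information of message and output block; by [condH_message] it equals that of codewords
    and output block. *)
Definition block_mi : R :=
  entropy B (fun w => w.1.2) - condH B (fun w => w.1.2) (fun w => w.1.1).

Lemma block_mi_le_diamond C1 C2 :
  entropy mu (fun w => [ffun i => (xs w i).1]) <= INR n * C1 ->
  entropy mu (fun w => [ffun i => (xs w i).2]) <= INR n * C2 ->
  block_mi <= INR n * diamond_bound C1 C2 W (avg_law mu xs) q.
Proof.
move=> hC1 hC2.
have V_pmf x : is_pmf (V x) by exact: W_pmf.
have n_R : 0 < INR n by exact/lt_0_INR/ltP.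
have [B0 B1] : is_pmf B by apply: block_law_pmf.
pose P := letter_law mu V q xs.
pose x (t : X1 * X2 * Y * U) := t.1.1.
pose x1 (t : X1 * X2 * Y * U) := t.1.1.1.
pose x2 (t : X1 * X2 * Y * U) := t.1.1.2.
pose y (t : X1 * X2 * Y * U) := t.1.2.
pose u (t : X1 * X2 * Y * U) := t.2.
pose l (A : finType) (f : X1 * X2 * Y * U -> A) := letterwise xs f.
(* The message keeps its law [mu] inside [B], which carries the two link constraints over to [B]. *)
have mu_x w : marg B (fun t => t.1.1) w = mu w.
  by apply: marg_chain_law_x => *; apply: block_kernel_pmf.
have mu_xE : marg B (fun t => t.1.1) = mu by apply: functional_extensionality.
have {}hC1 : entropy B (l _ x1) <= INR n * C1.
  by move: hC1; rewrite -mu_xE -entropy_comp.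
have {}hC2 : entropy B (l _ x2) <= INR n * C2.
  by move: hC2; rewrite -mu_xE -entropy_comp.
have lP (A : finType) (f : X1 * X2 * Y * U -> A) w w' :
    l _ f w = l _ f w' <-> forall i, f (letter xs w i) = f (letter xs w' i).
  split=> [/ffunP E i|E].
    by have := E i; rewrite !ffunE.
  by apply/ffunP => i; rewrite !ffunE.
have l12 w w' : l _ x w = l _ x w' <-> l _ x1 w = l _ x1 w' /\ l _ x2 w = l _ x2 w'.
  rewrite !lP; split=> [E|[E1 E2] i].
    by split=> i; have := E i; rewrite /x1 /x2 /x => ->.
  rewrite [LHS]surjective_pairing [RHS]surjective_pairing.
  by congr (_, _); [exact: E1 | exact: E2].
have Hx := entropy_split B0 B1 l12.
have Hyx := entropy_le_condH B0 (l _ y) (l _ x).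
have Hyx1 := entropy_le_condH B0 (l _ y) (l _ x1).
have Hyx2 := entropy_le_condH B0 (l _ y) (l _ x2).
have Hyu := condH_swap B0 (l _ y) (l _ u).
have Hsub := entropy_submod B0 B1 l12 (l _ u).
have Kyx : condH B (l _ y) (l _ x) = INR n * condH P y x by apply: condH_letterwise_yx.
have Kux : condH B (l _ u) (l _ x) = INR n * condH P u x by apply: condH_letterwise_ux.
have Kuy : condH B (l _ u) (l _ y) = INR n * condH P u y by apply: condH_letterwise_uy.
have Gy : entropy B (l _ y) <= INR n * entropy P y by apply: entropy_letterwise.
have G (A A' : finType) (f : X1 * X2 * Y * U -> A) (g : X1 * X2 * Y * U -> A') :
  condH B (l _ f) (l _ g) <= INR n * condH P f g by apply: condH_letterwise.
have Gyx1 := G _ _ y x1; have Gyx2 := G _ _ y x2; have Gyu := G _ _ y u.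
have Gux1 := G _ _ u x1; have Gux2 := G _ _ u x2.
have JE : block_mi = entropy B (l _ y) - condH B (l _ y) (l _ x).
  rewrite /block_mi (condH_message xs mu_pmf V_pmf q_pmf).
  by congr (entropy B _ - _); rewrite /l letterwise_y.
set J := block_mi / INR n.
have JnE : INR n * J = block_mi by rewrite /J; field; lra.
rewrite -JnE; apply: Rmult_le_compat_l; first lra.
rewrite JE in JnE.
have red a : INR n * J <= INR n * a -> J <= a by apply: Rmult_le_reg_l.
(* Here [n J <= H(X^n)] by [Hyx]; the next two use [H(Y^n) <= H(X_i^n) + H(Y^n|X_i^n)]. *)
have c1 : J <= C1 + C2 by apply: red; lra.
have c2 : J <= C1 + (condH P y x1 - condH P y x) by apply: red; lra.
have c3 : J <= C2 + (condH P y x2 - condH P y x) by apply: red; lra.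
have c4 : J <= entropy P y - condH P y x by apply: red; lra.
(* One copy of [n J] is bounded by [H(X^n)]; in the other, [H(Y^n)] is rewritten as
   [H(U^n) + H(Y^n|U^n) - H(U^n|Y^n)]. Then [Hsub] bounds [H(X^n) + H(U^n)]. *)
have c5 : J <= / 2 * (C1 + C2 + (condH P y u - condH P y x - condH P u y
    + condH P u x1 + condH P u x2 - condH P u x)).
  by apply: red; lra.
apply: diamond_bound_glb => //; first exact: avg_law_pmf.
by have : 2 * J <= C1 + C2 + (condH P y u - condH P y x - condH P u y
    + condH P u x1 + condH P u x2 - condH P u x) by lra.
Qed.

End BlockDiamond.

(** * Fano's inequality and codes *)

Lemma uniform_pmf m : leq 1 m -> is_pmf (uniform m).
Proof.
move=> m0; have m_R : 0 < INR m by exact/lt_0_INR/ltP.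
split=> [w|]; first exact/Rlt_le/Rinv_0_lt_compat.
by rewrite sumR_const Rinv_r; lra.
Qed.

(* Comparing [P(w|y)] with the law giving mass [1 - e] to the decoded message and
   spreading [e] uniformly. *)
Lemma fano (T Z : finType) (P : T -> R) (m : nat) (w : T -> 'I_m) (z : T -> Z)
    (dec : Z -> 'I_m) (e : R) :
  is_pmf P -> 0 < e < 1 ->
  condH P w z <= - log2 (1 - e) +
    sumR (fun t => if dec (z t) == w t then 0 else P t) * (log2 (INR m) - log2 e).
Proof.
move=> [P0 P1] e01.
(* Without messages there are no sample points, against total mass 1. *)
have [m0|m0] := posnP m.
  have T0 (t : T) : False by move: (w t); rewrite m0 => -[].
  by move: P1; rewrite /sumR big1; [lra | move=> t; case: (T0 t)].
have m_R : 1 <= INR m by rewrite -[1]/(INR 1); apply/le_INR/leP.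
pose k y w' := (if w' == dec y then 1 - e else 0) + e / INR m.
have e_m : 0 < e / INR m by apply: Rdiv_lt_0_compat; lra.
apply: (Rle_trans _ (- sumR (fun t => P t * log2 (k (z t) (w t))))).
  apply: (condH_le_cross P0 P1) => [y w'|y|t _].
  - by rewrite /k; case: ifP => _; lra.
  - rewrite sumR_add (sumR_delta (fun _ => 1 - e)) sumR_const.
    by apply: Req_le; field; lra.
  - by rewrite /k; case: ifP => _; lra.
pose E t := if dec (z t) == w t then 0 else P t.
have -> : - log2 (1 - e) + sumR E * (log2 (INR m) - log2 e) =
          - sumR (fun t => P t * log2 (1 - e) + E t * (log2 e - log2 (INR m))).
  by rewrite sumR_add !sumR_mulr P1; ring.
apply: Ropp_le_contravar; apply: sumR_le => t; rewrite /E /k eq_sym; case: ifP => _.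
  rewrite Rmult_0_l Rplus_0_r; apply: Rmult_le_compat_l => //.
  by apply: log2_le; lra.
rewrite -Rmult_plus_distr_l; apply: Rmult_le_compat_l => //.
rewrite Rplus_0_l /Rdiv log2M ?log2V; try lra; last by apply: Rinv_0_lt_compat; lra.
(* The two sides differ by [log2 (1 - e)], which is nonpositive. *)
have : log2 (1 - e) <= log2 1 by apply: log2_le; lra.
by rewrite log2_1; lra.
Qed.

Lemma entropy_uniform (m : nat) (T : finType) (P : T -> R) (w : T -> 'I_m) :
  is_pmf P -> marg P w = uniform m -> entropy P w = log2 (INR m).
Proof.
move=> [P0 P1] mE; rewrite entropyE // mE /uniform sumR_mulr P1 Rmult_1_l.
rewrite log2V ?Ropp_involutive //.
have [m0|m0] := posnP m; last exact/lt_0_INR/ltP.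
have T0 (t : T) : False by move: (w t); rewrite m0 => -[].
by move: P1; rewrite /sumR big1; [lra | move=> t; case: (T0 t)].
Qed.

(** For one code of small error, Fano's inequality gives [H(W|Y^n) <= d * log2 m + d] for the
    message [W]; the slack in [d] absorbs this loss. *)
Lemma code_diamond_bound (X1 X2 Y : finType) (W : X1 -> X2 -> Y -> R) (C1 C2 Rt d : R) :
  (forall x1 x2, is_pmf (W x1 x2)) -> 0 < d <= 1 -> achievable W C1 C2 Rt ->
  exists px : X1 * X2 -> R, is_pmf px /\
    forall (U : finType) (q : Y -> U -> R), (forall y, is_pmf (q y)) ->
      (1 - d) * Rt - d <= diamond_bound C1 C2 W px q.
Proof.
move=> W_pmf d01 ach.
(* Chosen so that the constant term [- log2 (1 - e)] of [fano] is exactly [d / 2]. *)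
pose e := 1 - Rpower 2 (- (d / 2)).
have e1 : e < 1 by have := exp_pos (- (d / 2) * ln 2); rewrite /e /Rpower; lra.
have e0 : 0 < e.
  have : Rpower 2 (- (d / 2)) < Rpower 2 0 by apply: Rpower_lt; lra.
  by rewrite /e Rpower_O; lra.
have le0 : log2 e <= 0 by rewrite -log2_1; apply: log2_le; lra.
(* The first entry bounds the coefficient of [log2 m] in [fano] by [d], the second bounds the term
   with [- log2 e] by [d / 2]; the [1 -] keeps the denominator positive. *)
pose eps := Rmin d (d / 2 / (1 - log2 e)).
have eps0 : 0 < eps by apply: Rmin_pos; [lra | apply: Rdiv_lt_0_compat; lra].
have [n [m [V1 [V2 [f1 [f2 [g1 [g2 [dec [n0 [mR [h1 [h2 err]]]]]]]]]]]]] := ach _ eps0.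
have m_R : 0 < INR m by apply: Rlt_le_trans (exp_pos _) mR.
have m0 : leq 1 m by case: (m) m_R => //=; lra.
have n_R : 1 <= INR n by rewrite -[1]/(INR 1); apply/le_INR/leP.
have mu_pmf := uniform_pmf m0.
pose xs w i := (g1 (f1 w) i, g2 (f2 w) i).
exists (avg_law (uniform m) xs); split=> [|U q q_pmf]; first exact: avg_law_pmf.
pose V (x : X1 * X2) := W x.1 x.2.
have V_pmf x : is_pmf (V x) by exact: W_pmf.
pose B := block_law (uniform m) V q xs.
have B_pmf : is_pmf B by apply: block_law_pmf.
have J_le : block_mi (uniform m) W q xs <=
            INR n * diamond_bound C1 C2 W (avg_law (uniform m) xs) q.
  have [mu0 _] := mu_pmf; apply: block_mi_le_diamond => //.
    apply: Rle_trans h1; apply: entropy_mono => // w w' E.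
    by apply/ffunP => i; rewrite !ffunE /xs /= E.
  apply: Rle_trans h2; apply: entropy_mono => // w w' E.
  by apply/ffunP => i; rewrite !ffunE /xs /= E.
have HW : entropy B (fun t => t.1.1) = log2 (INR m).
  apply: entropy_uniform => //; apply: functional_extensionality => w.
  by apply: marg_chain_law_x => *; apply: block_kernel_pmf.
have errE : sumR (fun t => if dec t.1.2 == t.1.1 then 0 else B t) <= eps.
  apply: Rle_trans err; apply: Req_le; rewrite /err_prob -sumR_mull.
  rewrite sumR_pair sumR_pair; apply: eq_sumR => w; rewrite -sumR_mull.
  apply: eq_sumR => y /=; case: ifP => _; first by rewrite /sumR big1_eq; lra.
  rewrite /B /block_law /chain_law /= sumR_mull.
  by rewrite (proj2 (block_kernel_pmf y q_pmf)) Rmult_1_r.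
have F := fano (fun t => t.1.1) (fun t => t.1.2) dec B_pmf (conj e0 e1).
have S := condH_swap (proj1 B_pmf) (fun t => t.1.1) (fun t => t.1.2).
have JE : block_mi (uniform m) W q xs =
  log2 (INR m) - condH B (fun t => t.1.1) (fun t => t.1.2).
  by rewrite /block_mi -/V -/B; lra.
have lm0 : 0 <= log2 (INR m).
  by rewrite -log2_1; apply: log2_le; [lra | rewrite -[1]/(INR 1); apply/le_INR/leP].
have lmR : INR n * Rt <= log2 (INR m).
  by rewrite -(log2_Rpower (INR n * Rt)); apply: log2_le => //; exact: exp_pos.
have l1e : - log2 (1 - e) = d / 2.
  have -> : 1 - e = Rpower 2 (- (d / 2)) by rewrite /e; lra.
  by rewrite log2_Rpower; lra.
have pe_d : eps <= d by exact: Rmin_l.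
have pe_e : eps * (1 - log2 e) <= d / 2.
  apply: (Rle_trans _ (d / 2 / (1 - log2 e) * (1 - log2 e))).
    by apply: Rmult_le_compat_r; [lra | exact: Rmin_r].
  by apply: Req_le; field; lra.
set pe := sumR _ in errE; rewrite -/pe in F.
have key : (1 - d) * log2 (INR m) - d <= block_mi (uniform m) W q xs.
  by rewrite JE; nra.
apply: (Rmult_le_reg_l (INR n)); first lra.
(* [d <= 1] allows [n Rt <= log2 m] to be multiplied by [1 - d], and [n >= 1] gives
   [- n d <= - d]. *)
by apply: Rle_trans J_le; apply: Rle_trans key; nra.
Qed.

(** * Continuity and compactness *)

Lemma Un_cv_const c : Un_cv (fun _ => c) c.
Proof.
by move=> eps eps0; exists 0%nat => k _; rewrite /Rdist Rminus_diag Rabs_R0.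
Qed.

Lemma Un_cv_ext (a b : nat -> R) l : (forall k, a k = b k) -> Un_cv a l -> Un_cv b l.
Proof. by move=> /functional_extensionality ->. Qed.

(** [phi k >= k] stands in for monotonicity: it suffices for limits and is preserved under
    composition. *)
Lemma Un_cv_subseq (a : nat -> R) l (phi : nat -> nat) :
  (forall k, leq k (phi k)) -> Un_cv a l -> Un_cv (fun k => a (phi k)) l.
Proof.
move=> phi_ge al eps /al[N aN]; exists N => k /leP Nk; apply: aN; apply/leP.
exact: leq_trans Nk (phi_ge k).
Qed.

Lemma Un_cv_sumR (T : finType) (a : nat -> T -> R) (l : T -> R) :
  (forall t, Un_cv (fun k => a k t) (l t)) -> Un_cv (fun k => sumR (a k)) (sumR l).
Proof.
move=> al; rewrite /sumR; elim: (index_enum T) => [|t s IH].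
  by rewrite big_nil; apply: Un_cv_ext (Un_cv_const 0) => k; rewrite big_nil.
rewrite big_cons; apply: Un_cv_ext (CV_plus _ _ _ _ (al t) IH) => k.
by rewrite big_cons.
Qed.

Lemma Un_cv_Rmin (a b : nat -> R) l l' :
  Un_cv a l -> Un_cv b l' -> Un_cv (fun k => Rmin (a k) (b k)) (Rmin l l').
Proof.
move=> al bl eps eps0; have [N aN] := al _ eps0; have [N' bN] := bl _ eps0.
exists (maxn N N') => k /leP; rewrite geq_max => /andP[/leP /aN + /leP /bN].
rewrite /Rdist => /Rabs_def2[? ?] /Rabs_def2[? ?]; apply: Rabs_def1.
  by rewrite /Rmin; case: Rle_dec; case: Rle_dec; lra.
by rewrite /Rmin; case: Rle_dec; case: Rle_dec; lra.
Qed.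

(** With [s = sqrt x], use [x ln x = 2 s (s ln s)] and [- ln s <= 1/s - 1]. The purpose is
    continuity of [x ln x] at 0. *)
Lemma mul_ln_bound x : 0 < x <= 1 -> Rabs (x * ln x) <= 2 * sqrt x.
Proof.
move=> x01; have s0 : 0 < sqrt x by apply: sqrt_lt_R0; lra.
have xE : x = sqrt x * sqrt x by rewrite sqrt_sqrt; lra.
have lnx : ln x <= 0.
  by case: (proj2 x01) => [h|->]; rewrite -?ln_1; [apply/Rlt_le/ln_increasing; lra | lra].
have h : 1 + - ln (sqrt x) <= / sqrt x.
  by have := exp_ineq1_le (- ln (sqrt x)); rewrite exp_Ropp exp_ln.
have E : ln x = 2 * ln (sqrt x) by rewrite {1}xE ln_mult //; lra.
have hs : sqrt x * / sqrt x = 1 by field; lra.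
rewrite Rabs_left1; last by nra.
rewrite {1}xE E; have : 0 <= sqrt x * (sqrt x * (/ sqrt x - (1 - ln (sqrt x)))).
  by apply: Rmult_le_pos; [lra | apply: Rmult_le_pos; lra].
by nra.
Qed.

Lemma Un_cv_xlog2x (a : nat -> R) l :
  (forall k, 0 <= a k) -> Un_cv a l -> Un_cv (fun k => xlog2x (a k)) (xlog2x l).
Proof.
move=> a0 al.
have l0 : 0 <= l by apply: (@Rle_cv_lim (fun _ => 0) a _ _ a0 (Un_cv_const 0) al).
(* At 0 the junk value of [ln] is multiplied by 0, so one formula covers all nonnegative
   arguments. *)
have xE x : 0 <= x -> xlog2x x = x * ln x * / ln 2.
  move=> x0; rewrite /xlog2x /log2; case: Rle_dec => //= [x0'|_]; last by rewrite /Rdiv; ring.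
  by have -> : x = 0 by [lra]; ring.
rewrite xE //; apply: (Un_cv_ext (a := fun k => a k * ln (a k) * / ln 2)).
  by move=> k; rewrite xE.
apply: CV_mult (Un_cv_const _).
have [lp|l_0] : 0 < l \/ l = 0 by lra.
  apply: CV_mult => //; apply: continuity_seq => //.
  apply: derivable_continuous_pt; exists (/ l); exact: derivable_pt_lim_ln.
have sa : Un_cv (fun k => sqrt (a k)) (sqrt l).
  by apply: continuity_seq => //; apply: continuity_pt_sqrt.
rewrite l_0 Rmult_0_l; rewrite l_0 sqrt_0 in al sa => eps eps0.
have e2 : 0 < eps / 2 by lra.
(* [N] makes [2 sqrt (a k)] smaller than [eps]; [N'] brings [a k] below 1, where [mul_ln_bound]
   applies. *)
have [N aN] := sa _ e2; have [N' bN] := al _ Rlt_0_1.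
exists (maxn N N') => k /leP; rewrite geq_max => /andP[/leP /aN + /leP /bN].
rewrite /Rdist !Rminus_0_r (Rabs_right (sqrt _)); last exact/Rle_ge/sqrt_pos.
rewrite (Rabs_right (a k)); last by apply/Rle_ge.
move=> s1 a1; have [ap|a_0] : 0 < a k \/ a k = 0 by have := a0 k; lra.
  by have := mul_ln_bound (conj ap (Rlt_le _ _ a1)); lra.
by rewrite a_0 Rmult_0_l Rabs_R0.
Qed.

Lemma Un_cv_entropy (T S : finType) (P : nat -> T -> R) (Q : T -> R) (f : T -> S) :
  (forall k t, 0 <= P k t) -> (forall t, Un_cv (fun k => P k t) (Q t)) ->
  Un_cv (fun k => entropy (P k) f) (entropy Q f).
Proof.
move=> P0 PQ; apply: CV_opp; apply: Un_cv_sumR => s; apply: Un_cv_xlog2x => [k|].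
  exact: marg_ge0.
by apply: Un_cv_sumR => t; case: ifP => _ //; exact: Un_cv_const.
Qed.

(** The joint law is linear in the input law, and every term is built from its entropies by
    continuous operations. *)
Lemma Un_cv_diamond_bound (X1 X2 Y U : finType) (C1 C2 : R)
    (W : X1 -> X2 -> Y -> R) (q : Y -> U -> R)
    (pk : nat -> X1 * X2 -> R) (px : X1 * X2 -> R) :
  (forall x1 x2, is_pmf (W x1 x2)) -> (forall y, is_pmf (q y)) ->
  (forall k, is_pmf (pk k)) -> (forall x, Un_cv (fun k => pk k x) (px x)) ->
  Un_cv (fun k => diamond_bound C1 C2 W (pk k) q) (diamond_bound C1 C2 W px q).
Proof.
move=> W_pmf q_pmf pk_pmf pk_cv.
have H (S : finType) (f : X1 * X2 * Y * U -> S) := @Un_cv_entropy _ S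
  ( fun k t => pk k (t.1.1.1, t.1.1.2) * W t.1.1.1 t.1.1.2 t.1.2 * q t.1.2 t.2)
  (fun t => px (t.1.1.1, t.1.1.2) * W t.1.1.1 t.1.1.2 t.1.2 * q t.1.2 t.2) f.
have {}H S f := H S f (fun k t => Rmult_le_pos _ _ (Rmult_le_pos _ _
    (proj1 (pk_pmf k) (t.1.1.1, t.1.1.2)) (proj1 (W_pmf t.1.1.1 t.1.1.2) t.1.2))
    (proj1 (q_pmf t.1.2) t.2))
  (fun t => CV_mult _ _ _ _ (CV_mult _ _ _ _ (pk_cv (t.1.1.1, t.1.1.2))
    (Un_cv_const _)) (Un_cv_const _)).
have Hcmi (A B C : finType) (a : _ -> A) (b : _ -> B) (c : _ -> C) :=
  CV_minus _ _ _ _ (CV_minus _ _ _ _ (CV_plus _ _ _ _ (H _ (pairRV a c))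
    (H _ (pairRV b c))) (H _ (pairRV (pairRV a b) c))) (H _ c).
have Hmi (A B : finType) (a : _ -> A) (b : _ -> B) :=
  CV_minus _ _ _ _ (CV_plus _ _ _ _ (H _ a) (H _ b)) (H _ (pairRV a b)).
rewrite /diamond_bound; apply: Un_cv_Rmin; first exact: Un_cv_const.
apply: Un_cv_Rmin; first by apply: CV_plus (Un_cv_const _) _; apply: Hcmi.
apply: Un_cv_Rmin; first by apply: CV_plus (Un_cv_const _) _; apply: Hcmi.
apply: Un_cv_Rmin; first exact: Hmi.
apply: CV_mult (Un_cv_const _) _; apply: CV_plus; last exact: Hcmi.
apply: CV_plus; last exact: Hcmi.
by apply: CV_plus (Un_cv_const _) _; apply: Hcmi.
Qed.

Lemma bounded_subseq (a : nat -> R) : (forall k, 0 <= a k <= 1) ->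
  exists (phi : nat -> nat) l, (forall k, leq k (phi k)) /\ Un_cv (fun k => a (phi k)) l.
Proof.
move=> a01; have [l al] := Bolzano_Weierstrass _ _ (compact_P3 0 1) a01.
(* Beyond each [k], an index is chosen whose value lies within [1/(k+1)] of the cluster point
   [l]. *)
have near k : { p | (k <= p)%coq_nat /\ Rabs (a p - l) < / (INR k + 1) }.
  apply: constructive_indefinite_description; apply: (al (fun x => Rabs (x - l) < _)).
  have k0 : 0 < / (INR k + 1) by apply: Rinv_0_lt_compat; have := pos_INR k; lra.
  by exists (mkposreal _ k0) => x.
exists (fun k => sval (near k)), l; split=> [k|].
  by apply/leP; case: (svalP (near k)).
move=> eps eps0; have [N [N1 N0]] := archimed_cor1 eps eps0.
exists N.+1 => k /leP Nk; apply: Rlt_trans (proj2 (svalP (near k))) _.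
apply: Rle_lt_trans N1; rewrite -S_INR; apply: Rinv_le_contravar.
  exact: lt_0_INR.
by apply/le_INR/leP; apply: ltnW; apply: leq_trans Nk (leqnSn k).
Qed.

(** Subsequences are extracted one coordinate at a time along the enumeration of [T]. *)
Lemma bounded_vector_subseq (T : finType) (a : nat -> T -> R) :
  (forall k t, 0 <= a k t <= 1) ->
  exists (phi : nat -> nat) (l : T -> R), (forall k, leq k (phi k)) /\
    forall t, Un_cv (fun k => a (phi k) t) (l t).
Proof.
move=> a01; suff [phi [l [phi_ge al]]] : exists (phi : nat -> nat) (l : T -> R),
    (forall k, leq k (phi k)) /\
    forall t, t \in enum T -> Un_cv (fun k => a (phi k) t) (l t).
  by exists phi, l; split=> // t; apply: al; rewrite mem_enum.
elim: (enum T) => [|x s [phi [l [phi_ge al]]]].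
  by exists (fun k => k), (fun _ => 0); split.
have [psi [b [psi_ge bl]]] := bounded_subseq (fun k => a01 (phi k) x).
exists (fun k => phi (psi k)), (fun t => if t == x then b else l t); split=> [k|t].
  exact: leq_trans (psi_ge k) (phi_ge _).
rewrite inE; case: eqP => [->|_] //= /al; exact: (Un_cv_subseq psi_ge).
Qed.

(** * Passing to the supremum of achievable rates *)

Lemma lub_approx (A : R -> Prop) s d : is_lub A s -> 0 < d ->
  exists x, A x /\ s - d < x.
Proof.
move=> [_ s_least] d0; apply: NNPP => no.
have : s <= s - d; last lra.
apply: s_least => x Ax; apply: Rnot_lt_le => sx; apply: no; by exists x.
Qed.

(** The max-min is rendered by an input law fixed before [U] and [q]. *)
Theorem theorem2 (X1 X2 Y : finType) (W : X1 -> X2 -> Y -> R) (C1 C2 : R) :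
  0 <= C1 -> 0 <= C2 ->
  (forall x1 x2, is_pmf (W x1 x2)) ->
  forall Cdiam : R, is_lub (achievable W C1 C2) Cdiam ->
  exists px : X1 * X2 -> R, is_pmf px /\
    forall (U : finType) (q : Y -> U -> R), (forall y, is_pmf (q y)) ->
      Cdiam <= diamond_bound C1 C2 W px q.
Proof.
move=> _ _ W_pmf C lubC.
pose d k : R := RinvN k.
have d0 k : 0 < d k by exact: cond_pos.
have d1 k : d k <= 1.
  rewrite /d /= -[X in _ <= X]Rinv_1.
  by apply: Rinv_le_contravar; have := pos_INR k; lra.
(* Choice turns the approximating laws into a sequence. Each is fixed before [q], so a single limit
   law serves every [q]. *)
have code k : { px : X1 * X2 -> R | is_pmf px /\
    forall (U : finType) (q : Y -> U -> R), (forall y, is_pmf (q y)) ->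
      (1 - d k) * (C - d k) - d k <= diamond_bound C1 C2 W px q }.
  apply: constructive_indefinite_description.
  have [Rt [ach Rt_gt]] := lub_approx lubC (d0 k).
  have [px [px_pmf H]] := code_diamond_bound W_pmf (conj (d0 k) (d1 k)) ach.
  exists px; split=> // U q /H; apply: Rle_trans.
  by have := d1 k; nra.
pose p k := sval (code k).
have p_pmf k : is_pmf (p k) by case: (svalP (code k)).
have p01 k x : 0 <= p k x <= 1.
  case: (p_pmf k) => p0 p1; split=> //; rewrite -p1; exact: sumR_ge_term.
have [phi [px [phi_ge p_cv]]] := bounded_vector_subseq p01.
have px_pmf : is_pmf px.
  split=> [x|].
    apply: (@Rle_cv_lim (fun _ => 0) _ _ _ _ (Un_cv_const 0) (p_cv x)) => k.
    by case: (p01 (phi k) x).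
  apply: UL_sequence (Un_cv_sumR p_cv) _; apply: Un_cv_ext (Un_cv_const 1) => k.
  by case: (p_pmf (phi k)).
exists px; split=> // U q q_pmf.
have d_cv : Un_cv (fun k => d (phi k)) 0 by apply: (Un_cv_subseq phi_ge); exact: RinvN_cv.
(* For fixed [q] the lower bounds tend to [(1 - 0) * (C - 0) - 0], the upper ones to the bound at
   the limit law. *)
have low_cv := CV_minus _ _ _ _ (CV_mult _ _ _ _
  (CV_minus _ _ _ _ (Un_cv_const 1) d_cv) (CV_minus _ _ _ _ (Un_cv_const C) d_cv)) d_cv.
have bound_cv := Un_cv_diamond_bound C1 C2 W_pmf q_pmf (fun k => p_pmf (phi k)) p_cv.
have := Rle_cv_lim _ low_cv bound_cv; rewrite !Rminus_0_r Rmult_1_l; apply=> k.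
by case: (svalP (code (phi k))) => _ /(_ U q q_pmf).
Qed.
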